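(* $$\frac{n^{5/6}}{(\log n)^{5/3}}\ll F_{9,3}(n)-\left(\pi(n)+\pi\left(\frac n2\right)\right)\ll n^{5/6}.$$
   Context: $\log$ is the natural logarithm, $\pi(x)$ is the number of primes not exceeding $x$. $X\ll Y$ means there is an absolute constant $c>0$ with $X\le cY$ for all sufficiently large $n$. $F_{k,d}(n)$ is the maximal size of a set $A\subseteq\{1,\dots,n\}$ such that the equation $a_1a_2\cdots a_k=x^d$ with $a_1<a_2<\dots<a_k$ has no solution with $a_1,\dots,a_k\in A$ and $x$ an integer. *)

(* Defs.v *)
From mathcomp Require Import all_boot all_order all_algebra.
From mathcomp Require Import all_classical all_reals all_analysis.

Set Implicit Arguments.
Unset Strict Implicit.
Unset Printing Implicit Defensive.

Import Order.TTheory GRing.Theory Num.Theory.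

Local Open Scope ring_scope.

Definition primepi (R : realType) (x : R) : nat :=
  #|[set p : 'I_(Num.truncn x).+1 | prime p]|.

Definition has_power_product (k d n : nat) (A : {set 'I_n.+1}) : Prop :=
  exists (a : 'I_k -> 'I_n.+1) (x : int),
    [/\ {homo a : i j / (i < j)%N},
        forall i, a i \in A
      & \prod_(i < k) (a i : nat)%:Z = x ^+ d].

(* Subsets of {1, ..., n} are the subsets of {0, ..., n} that avoid 0. *)
Definition power_product_free (k d n : nat) (A : {set 'I_n.+1}) : Prop :=
  ord0 \notin A /\ ~ has_power_product k d A.

(* For k = 0 no set is admissible and the maximum is 0 by convention; for
   k >= 1 the empty set is admissible. *)
Definition Fkd (k d n : nat) : nat :=
  \max_(A : {set 'I_n.+1} | `[< power_product_free k d A >]) #|A|.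

Definition vinogradov_le (R : realType) (X Y : nat -> R) : Prop :=
  exists2 c : R, 0 < c & \forall n \near \oo%classic, X n <= c * Y n.

(* Main.v *)
Require Import Defs.
From mathcomp Require Import all_boot all_order all_algebra all_field.
From mathcomp Require Import all_classical all_reals all_analysis.
From mathcomp Require Import ring lra zify.

(** Both bounds rest on the complete bipartite graph K_{3,3}: the product of the
    nine numbers [u_i * v_j] is the cube of [u_1 u_2 u_3 v_1 v_2 v_3].

    Upper bound. Let [n < T ^ 6] with [T] of order [n ^ (1/6)]. Every [m <= n]
    is a product [u * v] with [u, v < T ^ 3], or with [T ^ 3 <= u <= T ^ 5], or
    with [u] prime and [v < T]. Choosing one such factorisation for each element
    of an admissible set gives K_{3,3}-free bipartite graphs. In such a graph
    [\sum_u (deg u - 2) ^ 3 <= 2 |V| ^ 3], because three vertices of [V] have at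
    most two common neighbours; hence there are O(a^3 + a^2 b) edges if
    [|U| <= a^3] and [|V| <= b]. Cutting the range of [u] at powers of 8 and
    summing gives O(T^5) for the first two kinds. For the third kind the same
    inequality bounds the edges beyond two at each prime by 2 T^3, and the
    remaining ones are counted by [pi(n) + pi(n/2)], as a prime of degree at
    least 2 is at most [n / 2].

    Lower bound. With [s] of order [sqrt n], take the primes [p > s], the numbers
    [2 p] with [p > s] prime, and the products [p * r] over the edges of a dense
    K_{3,3}-free bipartite graph whose vertices are distinct primes up to [s].
    A prime [p > s] divides at most two of these numbers, so nine of them whose
    product is a cube all come from edges; every prime then divides a multiple of
    three of them, so nine edges meet at most 3 vertices on each side. The graph
    is the projective norm graph of Alon, Ronyai and Szabo over the field with
    [4 ^ k] elements, which has about [N ^ (5/3)] edges on [N] vertices, and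
    Chebyshev's bound makes [N] of order at least [sqrt n / log n]. *)

Set Implicit Arguments.
Unset Strict Implicit.
Unset Printing Implicit Defensive.

Import Order.TTheory GRing.Theory Num.Theory.

(** * K_{3,3}-free bipartite graphs *)

Definition K33_free (U V : finType) (e : U -> pred V) : Prop :=
  forall (f : 'I_3 -> U) (g : 'I_3 -> V), injective f -> injective g ->
    ~ (forall i j, e (f i) (g j)).

Lemma card_le_inj (I T : finType) (P : pred T) :
  #|I| <= #|P| -> exists2 f : I -> T, injective f & forall i, P (f i).
Proof.
move=> IP; exists (fun i => enum_val (widen_ord IP (enum_rank i))).
  by move=> i j /enum_val_inj/(congr1 val) /= /ord_inj/enum_rank_inj.
by move=> i; have := enum_valP (widen_ord IP (enum_rank i)).
Qed.

(** Double counting of pairs [(u, g)] with [g] an injective triple of neighbours of [u]: a vertex of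
    degree [d >= 2] has [d (d - 1) (d - 2) >= (d - 2) ^ 3] triples, and three vertices sharing one
    triple form a K_{3,3}. *)
Lemma sum_deg_cube (U V : finType) (e : U -> pred V) :
  K33_free e -> \sum_u (#|e u| - 2) ^ 3 <= 2 * #|V| ^ 3.
Proof.
move=> eF.
pose T3 u := [set g in ffun_on (e u) | injectiveb (g : {ffun 'I_3 -> V})].
have le_T3 u : (#|e u| - 2) ^ 3 <= #|T3 u|.
  rewrite card_inj_ffuns_on card_ord.
  case: #|e u| => [|[|d]] //; rewrite 3!ffactnS ffactn0 /=; nia.
apply: leq_trans (leq_sum _ (fun u _ => le_T3 u)) _.
under eq_bigr do rewrite -sum1_card.
rewrite (exchange_big_dep predT) //=.
have -> : 2 * #|V| ^ 3 = \sum_(g : {ffun 'I_3 -> V}) 2.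
  by rewrite sum_nat_const card_ffun card_ord mulnC.
apply: leq_sum => g _; rewrite sum1_card leqNgt.
apply/negP; rewrite -[X in X <= _](card_ord 3) => /card_le_inj[f fI fP].
have {}fP i : g \in T3 (f i) := fP i.
have gI : injective g by have := fP ord0; rewrite !inE => /andP[_ /injectiveP].
apply: (eF f g fI gI) => i j; have := fP i.
by rewrite !inE => /andP[/ffun_onP/(_ j)].
Qed.

Lemma sum_deg_le (U V : finType) (e : U -> pred V) (a b : nat) :
    0 < a -> 0 < b -> #|U| <= a ^ 3 -> #|V| <= b -> K33_free e ->
  \sum_u #|e u| <= 2 * a ^ 3 + 3 * a ^ 2 * b.
Proof.
move=> a0 b0 leU leV eF.
have le1 : \sum_u #|e u| <= 2 * #|U| + \sum_u (#|e u| - 2).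
  rewrite mulnC -sum_nat_const -big_split; apply: leq_sum => u _.
  by rewrite -leq_subLR.
apply: leq_trans le1 _; apply: leq_add; first by rewrite leq_mul2l leU.
(* This is [y <= b / a + a ^ 2 * y ^ 3 / b ^ 2] without denominators, weighted so that both terms
   sum over [U] to multiples of [a ^ 2 * b]. *)
have key y : a * b ^ 2 * y <= b ^ 3 + a ^ 3 * y ^ 3.
  have -> : a * b ^ 2 * y = b ^ 2 * (a * y) by rewrite mulnAC mulnC.
  have [le|/ltnW le] := leqP (a * y) b.
    by apply: leq_trans (leq_addr _ _); rewrite [b ^ 3]expnSr leq_mul2l le orbT.
  apply: leq_trans (leq_addl _ _); rewrite -expnMn [_ ^ 3]expnSr.
  by rewrite leq_mul2r leq_exp2r // le orbT.
rewrite -(leq_pmul2l (_ : 0 < a * b ^ 2)); last by rewrite muln_gt0 a0 expn_gt0 b0.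
rewrite big_distrr /=; apply: leq_trans (leq_sum _ (fun u _ => key _)) _.
rewrite big_split /= sum_nat_const -big_distrr /=.
have -> : a * b ^ 2 * (3 * a ^ 2 * b) = a ^ 3 * b ^ 3 + a ^ 3 * (2 * b ^ 3).
  ring.
apply: leq_add; first by rewrite leq_mul2r leU orbT.
rewrite leq_mul2l; apply/orP; right; apply: leq_trans (sum_deg_cube eF) _.
by rewrite leq_mul2l leq_exp2r ?leV ?orbT.
Qed.

(** * Products along a bipartite graph *)

(** Trades increasing sequences for plain subsets: a subset is enumerated in increasing order, and
    [x] may be replaced by its absolute value because the product is nonnegative. *)
Lemma has_power_productP (k d n : nat) (A : {set 'I_n.+1}) :
  has_power_product k d A <->
  exists W : {set 'I_n.+1}, [/\ W \subset A, #|W| = k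
    & exists x : nat, \prod_(m in W) (m : nat) = x ^ d].
Proof.
have prod_im (a : 'I_k -> 'I_n.+1) : injective a ->
    (\prod_(i < k) (a i : nat)%:Z)%R = Posz (\prod_(m in a @: 'I_k) m).
  move=> aI; rewrite big_imset /=; last by move=> i j _ _ /aI.
  by rewrite (big_morph Posz PoszM (erefl 1%:Z%R)).
split=> [[a [x [amono aA prodE]]]|[W [WA Wk [x prodE]]]].
  have aI : injective a.
    move=> i j aE; case: (ltngtP i j) => [/amono|/amono|/ord_inj//];
      by rewrite aE ltnn.
  exists (a @: 'I_k); split.
  - by apply/fintype.subsetP=> _ /imsetP[i _ ->].
  - by rewrite card_imset // card_ord.
  by exists `|x|%N; rewrite -abszX -prodE prod_im.
pose a i := Order.enum_val (cast_ord (esym Wk) i).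
have aI : injective a by move=> i j /Order.enum_val_inj/cast_ord_inj.
have aW : a @: 'I_k = W.
  apply/eqP; rewrite eqEcard card_imset // card_ord Wk leqnn andbT.
  by apply/fintype.subsetP=> _ /imsetP[i _ ->]; apply: Order.enum_valP.
exists a, x%:Z%R; split.
- move=> i j ij; change (a i < a j)%O; rewrite lt_neqAle.
  rewrite (inj_eq aI) -val_eqE /= ltn_eqF //.
  by rewrite Order.le_enum_val; [exact: ltnW|exact: le_total].
- by move=> i; apply: (fintype.subsetP WA); rewrite -aW imset_f.
- by rewrite prod_im // aW prodE -rmorphXn.
Qed.

(** The edge set is [r @: S]. As [m] is recovered from [r m], nine edges forming a K_{3,3} come from
    nine distinct elements of [A], and in their product each vertex label occurs three times. *)
Lemma K33_free_products (n : nat) (A S : {set 'I_n.+1}) (U V : finType)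
    (f : U -> nat) (g : V -> nat) (r : 'I_n.+1 -> U * V) :
    injective f -> injective g ->
    power_product_free 9 3 A -> S \subset A ->
    (forall m, m \in S -> f (r m).1 * g (r m).2 = m) ->
  exists e : U -> pred V, [/\ K33_free e, #|S| = \sum_u #|e u|
    & forall u v, e u v -> exists2 m, m \in S & r m = (u, v)].
Proof.
move=> fI gI [_ Afree] SA rS.
have rI : {in S &, injective r}.
  by move=> m m' mS m'S rE; apply: val_inj; rewrite /= -(rS m) // rE rS.
exists (fun u v => (u, v) \in r @: S); split.
- move=> a b aI bI ab.
  have abS i j : exists2 m : 'I_n.+1, m \in S & (a i, b j) = r m.
    by case/imsetP: (ab i j) => m mS ->; exists m.
  pose w i j := s2val (cid2 (abS i j)).
  have wS i j : w i j \in S by rewrite /w; case: cid2.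
  have wr i j : r (w i j) = (a i, b j) by rewrite /w; case: cid2 => ? ? /= <-.
  pose h (ij : 'I_3 * 'I_3) := w ij.1 ij.2.
  have hI : injective h.
    move=> [i j] [i' j']; rewrite /h /= => /(congr1 r).
    by rewrite !wr => -[/aI-> /bI->].
  apply/Afree/has_power_productP; exists (h @: {: 'I_3 * 'I_3}); split.
  + by apply/fintype.subsetP=> _ /imsetP[ij _ ->];
      exact: (fintype.subsetP SA _ (wS _ _)).
  + by rewrite card_imset // card_prod card_ord.
  exists ((\prod_i f (a i)) * (\prod_j g (b j))).
  rewrite big_imset /=; last by move=> i j _ _ /hI.
  under eq_bigl do rewrite inE.
  have hE ij : true -> h ij = f (a ij.1) * g (b ij.2) :> nat.
    by move=> _; rewrite -(rS _ (wS _ _)) wr.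
  rewrite (eq_bigr _ hE) -(pair_bigA _ (fun i j => f (a i) * g (b j))) /=.
  under eq_bigr do rewrite big_split prod_nat_const card_ord /=.
  rewrite big_split prod_nat_const card_ord /= expnMn; congr (_ * _).
  by rewrite (big_morph (fun x => x ^ 3) (fun x y => expnMn x y 3) (exp1n 3)).
- rewrite -(card_in_imset rI); under eq_bigr do rewrite -sum1_card.
  by rewrite pair_big_dep /= -sum1_card; apply: eq_bigl => -[].
- by move=> u v /imsetP[m mS ->]; exists m.
Qed.

(** * The upper bound *)

Lemma card_products_le (n a b : nat) (A S : {set 'I_n.+1}) :
    0 < a -> 0 < b -> power_product_free 9 3 A -> S \subset A ->
    (forall m, m \in S -> exists u v : nat, [/\ u < a ^ 3, v < b & u * v = m]) ->
  #|S| <= 2 * a ^ 3 + 3 * a ^ 2 * b.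
Proof.
move=> a0 b0 Afree SA Suv.
have /fin_all_exists[r rS] (m : 'I_n.+1) :
    exists w : 'I_(a ^ 3) * 'I_b, m \in S -> w.1 * w.2 = m.
  have [mS|_] := boolP (m \in S).
    by have [u [v [ua vb uv]]] := Suv m mS; exists (Ordinal ua, Ordinal vb).
  have a30 : 0 < a ^ 3 by rewrite expn_gt0 a0.
  by exists (Ordinal a30, Ordinal b0).
have [e [eF -> _]] := K33_free_products val_inj val_inj Afree SA rS.
by apply: sum_deg_le => //; rewrite card_ord.
Qed.

Lemma card_prime_multiples_le (n T : nat) (A S : {set 'I_n.+1}) :
    0 < T -> power_product_free 9 3 A -> S \subset A ->
    (forall m, m \in S -> exists p v : nat, [/\ prime p, v < T & p * v = m]) ->
  #|S| <= #|[set p : 'I_n.+1 | prime p]|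
          + #|[set p : 'I_n.+1 | prime p && (p.*2 <= n)]| + 2 * T ^ 3.
Proof.
move=> T0 Afree SA Spv.
have S0 (m : 'I_n.+1) : m \in S -> 0 < m.
  move=> mS; rewrite lt0n; apply: contraNneq Afree.1 => m0.
  by rewrite (_ : ord0 = m) ?(fintype.subsetP SA) //; apply/val_inj.
have /fin_all_exists[r rS] (m : 'I_n.+1) : exists w : 'I_n.+1 * 'I_T,
    m \in S -> prime w.1 /\ w.1 * w.2 = m.
  have [mS|_] := boolP (m \in S); last by exists (ord0, Ordinal T0).
  have [p [v [pp vT pv]]] := Spv m mS.
  have v0 : 0 < v by case: v pv {vT} => // pv; have := S0 m mS; rewrite -pv muln0.
  have pn : p < n.+1 by apply: leq_ltn_trans (ltn_ord m); rewrite -pv leq_pmulr.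
  by exists (Ordinal pn, Ordinal vT).
have [e [eF -> eS]] :=
  K33_free_products val_inj val_inj Afree SA (fun m mS => (rS m mS).2).
have e_prop (p : 'I_n.+1) (v : 'I_T) : e p v -> [/\ prime p, 0 < v & p * v <= n].
  move=> /eS[m mS rE]; have [pp mE] := rS m mS; rewrite rE /= in pp mE.
  split=> //; last by rewrite mE -ltnS.
  by have := S0 m mS; rewrite -mE muln_gt0 => /andP[].
(* Two distinct positive multiples of [p] up to [n] force [2 p <= n]; so a degree [d >= 2] is paid
   for by both indicators and [d - 2 <= (d - 2) ^ 3]. *)
have deg_le (p : 'I_n.+1) : #|e p| <=
    prime p + (prime p && (p.*2 <= n)) + (#|e p| - 2) ^ 3.
  have [->//|/card_gt0P[v evp]] := posnP #|e p|.
  have [pp v0 pv] := e_prop p v evp; rewrite pp /=.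
  have [d1|d2] := leqP #|e p| 1; first by apply: leq_trans d1 _; lia.
  have -> : p.*2 <= n.
    have [v1 [v2 [ev1 ev2 v12]]] := card_gt1P d2.
    have [_ ? ?] := e_prop p v1 ev1; have [_ ? ?] := e_prop p v2 ev2.
    have : v1 != v2 :> nat by rewrite val_eqE.
    nia.
  have : #|e p| - 2 <= (#|e p| - 2) ^ 3
    by case: (_ - 2) => // k; rewrite -[X in X <= _]expn1 leq_pexp2l.
  by move=> le; rewrite -leq_subLR.
apply: leq_trans (leq_sum _ (fun p _ => deg_le p)) _.
rewrite 2!big_split /= -!sum1_card.
rewrite [X in _ <= X + _ + _]big_mkcond [X in _ <= _ + X + _]big_mkcond /=.
apply: leq_add; last by have := sum_deg_cube eF; rewrite card_ord.
by apply: leq_add; apply: leq_sum => p _; rewrite inE; case: ifP.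
Qed.

(* The witness is the largest divisor [u <= T ^ 5] of [m]: if [u < T ^ 3], then
   maximality forces [m %/ u] to be 1 or a prime. *)
Lemma factor_trichotomy (T m : nat) : 0 < m < T ^ 6 ->
  [\/ exists u v, [/\ T ^ 3 <= u, u <= T ^ 5 & u * v = m],
      exists u v, [/\ u < T ^ 3, v < T ^ 3 & u * v = m]
    | exists p v, [/\ prime p, v < T & p * v = m]].
Proof.
case/andP=> m0 mT.
have T0 : 0 < T by case: T mT => //; rewrite exp0n.
pose P u := (u %| m) && (u <= T ^ 5).
have P1 : P 1 by rewrite /P dvd1n expn_gt0 T0.
have Pb u : P u -> u <= T ^ 5 by case/andP.
case: (@ex_maxnP P (T ^ 5) (ex_intro _ 1 P1) Pb) => u /andP[um uT] umax.
have mE : u * (m %/ u) = m by rewrite mulnC divnK.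
have u0 := dvdn_gt0 m0 um.
have [u3|u3] := leqP (T ^ 3) u; first by apply: Or31; exists u, (m %/ u).
have T45 : T ^ 4 <= T ^ 5 by rewrite leq_pexp2l.
set v := m %/ u in mE *.
have [v1|v1] := leqP v 1.
  apply: Or32; exists u, v; split=> //.
  by apply: leq_ltn_trans v1 (leq_ltn_trans u0 u3).
have pp := pdiv_prime v1; set p := pdiv v in pp.
have vE : v = p * (v %/ p) by rewrite mulnC divnK // pdiv_dvd.
set w := v %/ p in vE; have p1 := prime_gt1 pp.
have w0 : 0 < w by rewrite lt0n; apply: contraTneq v1 => w0; rewrite vE w0 muln0.
(* The divisor [u * p] is larger than [u], so maximality pushes it above [T ^ 5]; the cofactor [w]
   is then below [T]. *)
have upT : T ^ 5 < u * p.
  rewrite ltnNge; apply/negP => le; have : P (u * p).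
    by rewrite /P le andbT -mE vE mulnA dvdn_mulr.
  by move/umax; rewrite -[X in _ <= X]muln1 leq_pmul2l // leqNgt p1.
have wT : w < T.
  rewrite -(ltn_pmul2l (_ : 0 < u * p)); last by rewrite muln_gt0 u0 prime_gt0.
  rewrite -mulnA -vE mE; apply: leq_trans mT _.
  by rewrite [T ^ 6]expnSr leq_mul2r ltnW ?orbT.
(* The divisor [u * w] is at most [T ^ 4], so it competes with [u] in the maximum. *)
have w1 : w = 1.
  apply/eqP; rewrite eqn_leq w0 andbT -(leq_pmul2l u0) muln1.
  apply: umax; rewrite /P -[in X in X && _]mE vE.
  rewrite dvdn_pmul2l // dvdn_mull //=; apply: leq_trans T45.
  by rewrite expnSr leq_mul // ltnW.
rewrite w1 muln1 in vE; rewrite vE in mE.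
(* If [p <= T ^ 5], then [p] itself competes with [u], whence [p <= u < T ^ 3]; otherwise
   [u * p < T ^ 6] gives [u < T]. *)
have [pT|pT] := leqP p (T ^ 5).
  apply: Or32; exists u, p; split=> //; apply: leq_ltn_trans u3.
  by apply: umax; rewrite /P pT andbT -mE dvdn_mull.
apply: Or33; exists p, u; split=> //; last by rewrite mulnC.
rewrite -(ltn_pmul2r (_ : 0 < T ^ 5)) ?expn_gt0 ?T0 // -expnS.
by apply: leq_ltn_trans mT; rewrite -mE leq_mul2l ltnW ?orbT.
Qed.

Lemma sum_expn_le (c k : nat) : 1 < c -> \sum_(j < k) c ^ j <= c ^ k.
Proof.
move=> c1; elim: k => [|k IH]; first by rewrite big_ord0.
rewrite big_ord_recr /= expnS; apply: leq_trans (leq_add IH (leqnn _)) _.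
by rewrite addnn -mul2n leq_mul2r c1 orbT.
Qed.

Lemma sum_exp2_rev_le (N k : nat) : k <= N.+1 -> \sum_(j < k) 2 ^ (N - j) <= 2 ^ N.+1.
Proof.
move=> kN; suff : 2 ^ (N.+1 - k) + \sum_(j < k) 2 ^ (N - j) <= 2 ^ N.+1.
  by apply: leq_trans; apply: leq_addl.
elim: k kN => [|k IH] kN; first by rewrite big_ord0 subn0 addn0.
rewrite big_ord_recr /= subSS; apply: leq_trans (IH (ltnW kN)).
by rewrite (subSn (kN : k <= N)) expnS mul2n -addnn [X in _ <= X]addnAC addnA.
Qed.

Lemma card_power_product_free_le (s n : nat) (A : {set 'I_n.+1}) :
    n < (8 ^ s) ^ 6 -> power_product_free 9 3 A ->
  #|A| <= #|[set p : 'I_n.+1 | prime p]|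
          + #|[set p : 'I_n.+1 | prime p && (p.*2 <= n)]| + 178 * (8 ^ s) ^ 5.
Proof.
move=> nT Afree; set T := 8 ^ s.
have TE k : T ^ k = 2 ^ (3 * s * k) by rewrite /T -[8]/(2 ^ 3) -!expnM mulnA.
have T0 : 0 < T by rewrite expn_gt0.
(* Class [j] has [u < 8 ^ j * T ^ 3 = a j ^ 3] and [v < b j = 8 * T ^ 3 / 8 ^ j];
   for [0 < j] it contains the [m] with [8 ^ j.-1 * T ^ 3 <= u < 8 ^ j * T ^ 3]. *)
pose a j := 2 ^ (j + 3 * s); pose b j := 2 ^ (9 * s + 3 - 3 * j).
pose S j := [set m in A | `[< exists u v : nat,
  [/\ u < a j ^ 3, v < b j & u * v = m] >]].
pose B := [set m in A | `[< exists p v : nat,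
  [/\ prime p, v < T & p * v = m] >]].
(* Since [T ^ 5 = 8 ^ (2 * s) * T ^ 3], the quotient [u %/ T ^ 3] has base-8 logarithm at most
   [2 * s], and logarithm [i] goes to class [i.+1]. *)
pose k := 2 * s + 2.
have cover : A \subset B :|: \bigcup_(j < k) S j.
  apply/fintype.subsetP => m mA; rewrite inE.
  have m0 : 0 < m.
    rewrite lt0n; apply: contraNneq Afree.1 => m0.
    by rewrite (_ : ord0 = m) //; apply/val_inj.
  have mT : m < T ^ 6 by apply: leq_ltn_trans nT; rewrite -ltnS.
  have m0T : 0 < m < T ^ 6 by rewrite m0.
  case: (factor_trichotomy m0T) => [[u [v [u3 u5 uv]]]|[u [v [u3 v3 uv]]]|pv].
  - have u0 : 0 < u by apply: leq_trans u3; rewrite expn_gt0 T0.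
    have T30 : 0 < T ^ 3 by rewrite expn_gt0 T0.
    have q0 : 0 < u %/ T ^ 3 by rewrite divn_gt0.
    have /andP[] := trunc_log_bounds (isT : 1 < 8) q0.
    set i := trunc_log _ _; rewrite leq_divRL // ltn_divLR // => iu ui.
    have ik : i < 2 * s + 1.
      rewrite addn1 ltnS -(leq_exp2l _ _ (isT : 1 < 8)) -(leq_pmul2r T30).
      apply: leq_trans iu (leq_trans u5 _).
      by rewrite (_ : 8 ^ (2 * s) = T ^ 2) -?expnD // /T -expnM mulnC.
    have ik' : i.+1 < k by rewrite /k; lia.
    apply/orP; right; apply/bigcupP; exists (Ordinal ik') => //.
    rewrite inE mA; apply/asboolP; exists u, v; split=> //=.
      by apply: leq_trans ui _;
        rewrite /a TE -[8]/(2 ^ 3) -!expnM -expnD leq_exp2l //; lia.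
    rewrite -(ltn_pmul2l (_ : 0 < 8 ^ i * T ^ 3)) ?muln_gt0 ?expn_gt0 ?T0 //.
    apply: (@leq_ltn_trans (u * v)); first by rewrite leq_mul2r iu orbT.
    rewrite uv; apply: leq_trans mT _.
    by rewrite /b !TE -[8]/(2 ^ 3) -!expnM -!expnD leq_exp2l //; lia.
  - have k0 : 0 < k by rewrite /k addn2.
    apply/orP; right; apply/bigcupP; exists (Ordinal k0) => //.
    rewrite inE mA; apply/asboolP; exists u, v; split=> //=.
      by apply: leq_trans u3 _; rewrite /a TE -expnM leq_exp2l //; lia.
    by apply: leq_trans v3 _; rewrite /b TE leq_exp2l //; lia.
  - by rewrite inE mA; apply/orP; left; apply/asboolP.
apply: leq_trans (subset_leq_card cover) (leq_trans (leq_card_setU _ _) _).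
have BA : B \subset A by apply/fintype.subsetP => m /setIdP[].
have B_le := card_prime_multiples_le T0 Afree BA
  (fun m mB => asboolW (setIdP mB).2).
have S_le j : #|S j| <= 2 * a j ^ 3 + 3 * a j ^ 2 * b j.
  apply: (card_products_le _ _ Afree); rewrite ?expn_gt0 //.
    by apply/fintype.subsetP => m /setIdP[].
  by move=> m /setIdP[_ /asboolP].
(* The terms [2 * a j ^ 3] increase geometrically and give 128, the terms [3 * a j ^ 2 * b j]
   decrease geometrically and give 48. The primes later add [2 * T ^ 3], hence 178. *)
have sum_le : #|\bigcup_(j < k) S j| <= 176 * T ^ 5.
  have : #|\bigcup_(j < k) S j| <= \sum_(j < k) #|S j|.
    elim/big_rec2: _ => [|j x X _ le]; first by rewrite cards0.
    by apply: leq_trans (leq_card_setU _ _) _; rewrite leq_add2l.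
  move/leq_trans; apply.
  apply: leq_trans (leq_sum _ (fun (j : 'I_k) _ => S_le j)) _.
  rewrite big_split /=.
  have -> : \sum_(j < k) 2 * a j ^ 3 = 2 * T ^ 3 * \sum_(j < k) 8 ^ j.
    rewrite big_distrr; apply: eq_bigr => j _ /=.
    by rewrite /a TE -[8]/(2 ^ 3) -!expnM -mulnA -expnD; congr (_ * _ ^ _); lia.
  have -> : \sum_(j < k) 3 * a j ^ 2 * b j = 3 * \sum_(j < k) 2 ^ (15 * s + 3 - j).
    rewrite big_distrr; apply: eq_bigr => -[j jk] _ /=; rewrite /k in jk.
    by rewrite /a /b -!expnM -mulnA -expnD; congr (_ * _ ^ _); lia.
  have h1 : 2 * T ^ 3 * \sum_(j < k) 8 ^ j <= 128 * T ^ 5.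
    apply: leq_trans (leq_mul (leqnn _) (sum_expn_le _ _)) _ => //.
    by rewrite /k addn2 !expnS mulnC [2 * s]mulnC expnM -/T; nia.
  have h2 : 3 * \sum_(j < k) 2 ^ (15 * s + 3 - j) <= 48 * T ^ 5.
    rewrite -[48]/(3 * 16) -mulnA leq_mul2l /=.
    apply: leq_trans (sum_exp2_rev_le _) _; first by rewrite /k; lia.
    by rewrite TE -[16]/(2 ^ 4) -expnD leq_exp2l //; lia.
  by apply: leq_trans (leq_add h1 h2) _; rewrite -mulnDl.
have : T ^ 3 <= T ^ 5 by rewrite leq_pexp2l.
move: B_le sum_le; lia.
Qed.

(** * Norm graphs *)

(* With [N x := x ^+ q.+1], the common solutions [X] of [N (X + d1) = c1] and
   [N (X + d2) = c2] are at most two: subtracting the equations shows that the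
   difference [D] of two of them satisfies [D ^+ q = - D * (d ^+ q / d)] for
   [d := d1 - d2], so that the first one becomes linear in [D] after
   cancelling [D]. *)
Lemma norm_eqs_difference (K : fieldType) (q : nat) (d1 d2 X Y : K) :
    {morph (fun x : K => x ^+ q) : x y / x + y}%R -> X != Y ->
    ((X + d1) ^+ q.+1 = (Y + d1) ^+ q.+1)%R ->
    ((X + d2) ^+ q.+1 = (Y + d2) ^+ q.+1)%R ->
  ((X - Y) * (d1 - d2) ^+ q
     = (Y + d1) ^+ q * (d1 - d2) - (Y + d1) * (d1 - d2) ^+ q)%R.
Proof.
move=> qD XY.
have qB : {morph (fun x : K => x ^+ q) : x y / x - y}%R.
  by move=> x y /=; apply/eqP; rewrite -subr_eq opprK -qD subrK.
have D0 : (X - Y)%R != 0%R by rewrite subr_eq0.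
rewrite !exprS !qB !qD; move: (X ^+ q)%R (Y ^+ q)%R (d1 ^+ q)%R (d2 ^+ q)%R.
move=> Xq Yq d1q d2q E1 E2; apply: (mulfI D0).
set lhs := LHS; set rhs := RHS.
(* The difference of the two sides is an explicit combination of the two norm differences, which
   vanish by [E1] and [E2]. *)
suff -> : lhs = (rhs
    + (X + d1) * (((X + d1) * (Xq + d1q) - (Y + d1) * (Yq + d1q))
                  - ((X + d2) * (Xq + d2q) - (Y + d2) * (Yq + d2q)))
    - (d1 - d2) * ((X + d1) * (Xq + d1q) - (Y + d1) * (Yq + d1q)))%R.
  by rewrite E1 E2; ring.
by rewrite /lhs /rhs; ring.
Qed.

(** Dividing the equations of rows 1 and 2 by that of row 0 and substituting [X j = 1 / (A 0 + B j)]
    turns them into [N (X j + d i) = c i], with [c i] independent of [j]. The previous lemma then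
    gives [X 1 - X 0 = X 2 - X 0], contradicting the injectivity of [X]. *)
Lemma norm_graph_K33_free (K : fieldType) (q : nat) (A B a b : 'I_3 -> K) :
    {morph (fun x : K => x ^+ q) : x y / x + y}%R ->
    (forall i, a i != 0%R) -> (forall j, b j != 0%R) ->
    injective (fun i => (A i, a i)) -> injective (fun j => (B j, b j)) ->
  ~ (forall i j, (A i + B j) ^+ q.+1 = a i * b j)%R.
Proof.
move=> qD a0 b0 AaI BbI E.
have AB0 i j : (A i + B j)%R != 0%R.
  apply/eqP => ABE; have := E i j; rewrite ABE expr0n /= => /esym/eqP.
  by rewrite mulf_eq0 (negbTE (a0 i)) (negbTE (b0 j)).
have AI : injective A.
  move=> i i' AE; apply: AaI; rewrite AE; congr (_, _).
  by apply: (mulIf (b0 ord0)); rewrite -!E AE.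
have BI : injective B.
  move=> j j' BE; apply: BbI; rewrite BE; congr (_, _).
  by apply: (mulfI (a0 ord0)); rewrite -!E BE.
pose i1 : 'I_3 := inord 1; pose i2 : 'I_3 := inord 2.
have [i10 i20 i12] : [/\ i1 != ord0, i2 != ord0 & i1 != i2].
  by rewrite -!val_eqE /= !inordK.
pose X j := (A ord0 + B j)^-1%R; pose d i := (A i - A ord0)^-1%R.
have XI : injective X by move=> j j' /invr_inj/addrI/BI.
have d0 i : i != ord0 -> (A i - A ord0 != 0)%R.
  by move=> i0; rewrite subr_eq0 (inj_eq AI).
have XdE i j : i != ord0 ->
    ((X j + d i) ^+ q.+1 = a i / a ord0 * d i ^+ q.+1)%R.
  move=> i0; have -> : (X j + d i = (A i + B j) * X j * d i)%R.
    by rewrite /X /d; field; rewrite d0 // AB0.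
  by rewrite !exprMn E exprVn E; field; rewrite a0 b0.
have step i j : i != ord0 -> ((X j + d i) ^+ q.+1 = (X ord0 + d i) ^+ q.+1)%R.
  by move=> i0; rewrite !XdE.
have X_eq j : j != ord0 ->
    ((X j - X ord0) * (d i1 - d i2) ^+ q = (X ord0 + d i1) ^+ q * (d i1 - d i2)
       - (X ord0 + d i1) * (d i1 - d i2) ^+ q)%R.
  move=> j0; apply: norm_eqs_difference => //; rewrite ?(inj_eq XI) //; exact: step.
have dI : (d i1 - d i2 != 0)%R.
  by rewrite subr_eq0 (inj_eq invr_inj) (inj_eq (addIr _)) (inj_eq AI).
have := X_eq i1 i10; rewrite -(X_eq i2 i20) => /(mulIf (expf_neq0 q dI))/addIr/XI.
by move/eqP; apply/negP.
Qed.

Lemma exists_dense_K33_free (k : nat) : 0 < k ->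
  exists (V : finType) (e : V -> pred V), [/\ K33_free e, #|V| <= (2 ^ k) ^ 3
    & (2 ^ k) ^ 2 * (2 ^ k - 1) * ((2 ^ k) ^ 2 - 1) <= \sum_u #|e u|].
Proof.
move=> k0; set q := 2 ^ k; have q0 : 0 < q by rewrite expn_gt0.
have q1 : 1 < q by rewrite -[1]/(2 ^ 0) ltn_exp2l.
have k20 : 0 < k * 2 by rewrite muln_gt0 k0.
have [K charK cardK] := PrimePowerField (isT : prime 2) k20.
rewrite expnM -/q in cardK.
have qD : {morph (fun x : K => x ^+ q) : x y / x + y}%R.
  by move=> x y; apply: exprDn_pchar; rewrite (eq_pnat _ (pcharf_eq charK)) pnatX.
pose N (x : K) : K := (x ^+ q.+1)%R.
have NM x y : N (x * y)%R = (N x * N y)%R by rewrite /N exprMn.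
have N0 x : x != 0%R -> N x != 0%R by move=> x0; rewrite expf_neq0.
pose S : {set K} := [set N x | x in [set~ 0%R]].
have card_units : #|[set~ (0%R : K)]| = q ^ 2 - 1.
  by rewrite cardsC1 cardK subn1.
have S_unit (s : K) : s \in S -> exists2 x, x != 0%R & s = N x.
  by case/imsetP => x; rewrite !inE => x0 ->; exists x.
have S0 (s : K) : s \in S -> s != 0%R by case/S_unit => x /N0 Nx ->.
(* Norms of units are roots of unity of order dividing [q - 1], because [x ^ (q ^ 2) = x] in [K]. *)
have cardS_le : #|S| <= q.
  have : (#|S| <= q - 1)%N; last by move/leq_trans; apply; rewrite leq_subr.
  have q10 : 0 < q - 1 by rewrite subn_gt0.
  rewrite cardE; apply: max_unity_roots q10 _ (enum_uniq _).
  apply/allP => s; rewrite mem_enum => /S_unit[x x0 ->]; apply/unity_rootP.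
  apply: (mulIf (N0 x x0)); rewrite mul1r -exprSr subn1 prednK //.
  rewrite /N -exprM mulSn exprD mulnn -cardK expf_card.
  by rewrite exprSr.
(* The fibre of the norm over [s] consists of roots of a polynomial of degree [q + 1], and the
   fibres share [q ^ 2 - 1] units. *)
have cardS_ge : q - 1 <= #|S|.
  have : q ^ 2 - 1 <= #|S| * q.+1.
    rewrite -card_units -sum1_card (partition_big N (mem S)) /=; last first.
      by move=> x x0; apply: imset_f.
    rewrite -sum_nat_const; apply: leq_sum => s sS.
    rewrite sum1_card cardE.
    rewrite -ltnS -(size_XnsubC s (ltn0Sn q)); apply: max_poly_roots (enum_uniq _).
      by rewrite -size_poly_eq0 size_XnsubC.
    apply/allP => x; rewrite mem_enum => /andP[_ /eqP <-].
    by rewrite rootE !hornerE subrr.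
  nia.
pose V : finType := (K * {s : K | s \in S})%type.
pose e (u v : V) := (N (u.1 + v.1) == val u.2 * val v.2)%R.
have cardV : #|V| = q ^ 2 * #|S| by rewrite card_prod card_sig cardK.
exists V, e; split.
- move=> f g fI gI fg.
  apply: (@norm_graph_K33_free K q (fst \o f) (fst \o g)
    (fun i => val (f i).2) (fun i => val (g i).2)) => //.
  + by move=> i; apply: S0; apply: valP.
  + by move=> i; apply: S0; apply: valP.
  + move=> i j [] /= E1 E2; apply: fI; move: E1 E2.
    by case: (f i) (f j) => [x1 x2] [y1 y2] /= -> /val_inj ->.
  + move=> i j [] /= E1 E2; apply: gI; move: E1 E2.
    by case: (g i) (g j) => [x1 x2] [y1 y2] /= -> /val_inj ->.
  + by move=> i j; apply/eqP/fg.
- by rewrite cardV [q ^ 3]expnSr leq_mul2l cardS_le orbT.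
apply: (@leq_trans (\sum_(u : V) (q ^ 2 - 1))).
  rewrite sum_nat_const leq_mul2r; apply/orP; right.
  by rewrite -[#|_|]/#|V| cardV leq_mul2l cardS_ge orbT.
apply: leq_sum => -[A [a aS]] _.
have [y y0 aE] := S_unit a aS.
have bS (x : K) : x != 0%R -> (N x / a)%R \in S.
  move=> x0; apply/imsetP; exists (x / y)%R; first by rewrite !inE mulf_neq0 ?invr_eq0.
  by rewrite NM aE /N exprVn.
(* Each unit [x] yields its own neighbour of [(A, a)]: the first coordinates add up to [x], and the
   second ones multiply to [N x]. *)
pose nbr (x : {x : K | x != 0%R}) : V :=
  (val x - A, Sub (N (val x) / a) (bS _ (valP x)))%R.
have nbrI : injective nbr by move=> x x' [] /addIr/val_inj.
have <- : #|{: {x : K | x != 0%R}}| = q ^ 2 - 1.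
  by rewrite card_sig -card_units; apply: eq_card => x; rewrite !inE.
rewrite -(card_codom nbrI); apply/subset_leq_card/fintype.subsetP => _ /codomP[x ->].
rewrite unfold_in /e /= addrC subrK; apply/eqP.
by rewrite mulrC divfK // S0.
Qed.

(** * Chebyshev's lower bound *)

Lemma expn2_le_central_bin (m : nat) : 2 ^ m <= 'C(m.*2, m).
Proof.
elim: m => [|m IH]; first by rewrite bin0.
rewrite doubleS binS -[X in X + _]bin_sub; last by rewrite -addnn; lia.
have -> : m.*2.+1 - m.+1 = m by rewrite -addnn; lia.
rewrite addnn -mul2n expnS leq_mul2l /=; apply: leq_trans IH _.
by case: m => // m; rewrite binS leq_addr.
Qed.

(** By Legendre's formula the exponent of [p] is the sum over [i] of the carries [n %/ p ^ i - m %/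
    p ^ i - (n - m) %/ p ^ i]. Each is 0 or 1, and it is 0 once [p ^ i > n]. *)
Lemma expn_logn_bin_le (p n m : nat) : prime p -> 0 < n -> m <= n ->
  p ^ logn p 'C(n, m) <= n.
Proof.
move=> pp n0 mn; have p1 := prime_gt1 pp.
have wide k : k <= n -> logn p k`! = \sum_(1 <= i < n.+1) k %/ p ^ i.
  move=> kn; rewrite logn_fact // [RHS](big_cat_nat _ (n := k.+1)) //=.
  rewrite [X in _ = _ + X]big_nat [X in _ = _ + X]big1 ?addn0 // => i /andP[ki _].
  by rewrite divn_small //; apply: leq_trans ki (ltnW (ltn_expl _ p1)).
apply: leq_trans (trunc_logP p1 n0); rewrite leq_exp2l //.
have := congr1 (logn p) (bin_fact mn).
rewrite !lognM ?muln_gt0 ?fact_gt0 ?bin_gt0 // !wide ?leq_subr //.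
set sm := \sum_(_ <= _ < _) m %/ _; set snm := \sum_(_ <= _ < _) (n - m) %/ _.
suff : \sum_(1 <= i < n.+1) n %/ p ^ i <= sm + snm + trunc_log p n.
  by move=> le E; rewrite -E in le; move: le; rewrite addnC leq_add2l.
rewrite -big_split /=.
have <- : \sum_(1 <= i < n.+1) (i <= trunc_log p n : nat) = trunc_log p n.
  have tn : trunc_log p n <= n.
    by apply: ltnW; apply: leq_trans (ltn_expl _ p1) (trunc_logP p1 n0).
  rewrite (big_cat_nat _ (n := (trunc_log p n).+1)) //=.
  rewrite [X in X + _](eq_big_nat _ _ (F2 := fun=> 1)); last first.
    by move=> i /andP[_]; rewrite ltnS => ->.
  rewrite sum_nat_const_nat subn1 muln1 [X in _ + X]big_nat big1 ?addn0 //.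
  by move=> i /andP[ti _]; rewrite leqNgt ti.
rewrite -big_split /=; apply: leq_sum => i _.
rewrite -[in X in X <= _](subnKC mn) divnD ?expn_gt0 ?prime_gt0 // leq_add2l.
have [_|ti] := leqP i (trunc_log p n); first exact: leq_b1.
have pin : n < p ^ i by apply: leq_trans (trunc_log_ltn n p1) _; rewrite leq_exp2l.
by rewrite !modn_small ?subnKC ?(leq_ltn_trans _ pin) ?leq_subr //
  [p ^ i <= n]leqNgt pin.
Qed.

Lemma bin_le_expn_card_primes (n m : nat) : 0 < n -> m <= n ->
  'C(n, m) <= n ^ #|[set p : 'I_n.+1 | prime p]|.
Proof.
move=> n0 mn; have C0 : 0 < 'C(n, m) by rewrite bin_gt0.
rewrite [X in X <= _](prod_prime_decomp C0) prime_decompE big_map /=.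
apply: (@leq_trans (\prod_(p <- primes 'C(n, m)) n)).
  rewrite big_seq [X in _ <= X]big_seq; apply: leq_prod => p.
  by rewrite mem_primes => /and3P[pp _ _]; apply: expn_logn_bin_le.
rewrite big_const_seq count_predT iter_muln_1 leq_pexp2l // cardE.
rewrite -(size_map val); apply: uniq_leq_size (primes_uniq _) _ => p.
rewrite mem_primes => /and3P[pp _ pC].
have pn : p < n.+1.
  rewrite ltnS leqNgt; apply/negP => np; have : p ^ 1 <= n; last first.
    by rewrite expn1 leqNgt np.
  apply: leq_trans (expn_logn_bin_le pp n0 mn); rewrite leq_exp2l ?prime_gt1 //.
  by rewrite logn_gt0 mem_primes pp C0.
by apply/mapP; exists (Ordinal pn) => //; rewrite mem_enum inE.
Qed.

(** Compares exponents of 2 in the lower and upper bounds for the central binomial coefficient of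
    [2 ^ e]. *)
Lemma card_primes_expn2_ge (e : nat) : 0 < e ->
  2 ^ e.-1 <= e * #|[set p : 'I_(2 ^ e).+1 | prime p]|.
Proof.
case: e => // e _ /=; rewrite -(leq_exp2l _ _ (isT : 1 < 2)).
apply: leq_trans (expn2_le_central_bin _) _; rewrite expnM.
rewrite -mul2n -expnS; apply: bin_le_expn_card_primes; first by rewrite expn_gt0.
by rewrite leq_exp2l.
Qed.

(** * The lower bound construction *)

Lemma card_image_fibers_le (T U : finType) (f : T -> U) (E : {set T}) (d : nat) :
    (forall u, d %| #|[set w in E | f w == u]|) -> d * #|f @: E| <= #|E|.
Proof.
move=> fib; rewrite -[X in _ <= X]sum1_card.
rewrite (partition_big f (mem (f @: E))) /=; last by move=> w; apply: imset_f.
rewrite mulnC -sum_nat_const; apply: leq_sum => u /imsetP[w wE uE].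
have -> : \sum_(w in E | f w == u) 1 = #|[set w in E | f w == u]|.
  by rewrite -sum1_card; apply: eq_bigl => w'; rewrite !inE.
by apply: dvdn_leq (fib u); apply/card_gt0P; exists w; rewrite inE wE uE eqxx.
Qed.

(** Nonempty fibres have at least three elements, so each projection of [E] has at most three
    values; nine edges then fill the whole product of the two images. *)
Lemma nine_edges_K33 (U V : finType) (E : {set U * V}) : #|E| = 9 ->
    (forall u, 3 %| #|[set w in E | w.1 == u]|) ->
    (forall v, 3 %| #|[set w in E | w.2 == v]|) ->
  exists (f : 'I_3 -> U) (g : 'I_3 -> V),
    [/\ injective f, injective g & forall i j, (f i, g j) \in E].
Proof.
move=> E9 /card_image_fibers_le; rewrite E9 => X3.
move=> /card_image_fibers_le; rewrite E9 => Y3.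
set X := (X in 3 * #|pred_of_set X| <= _) in X3.
set Y := (X in 3 * #|pred_of_set X| <= _) in Y3.
have EXY : E \subset finset.setX X Y.
  by apply/fintype.subsetP => w wE; rewrite inE !imset_f.
have := subset_leq_card EXY; rewrite cardsX E9 => XY9.
have [cX cY] : 3 = #|X| /\ 3 = #|Y| by nia.
have {}EXY : E = finset.setX X Y.
  by apply/eqP; rewrite eqEcard EXY cardsX -cX -cY E9.
have [f fI fX] : exists2 f : 'I_3 -> U, injective f & forall i, mem X (f i).
  by apply: card_le_inj; rewrite card_ord cX.
have [g gI gY] : exists2 g : 'I_3 -> V, injective g & forall i, mem Y (g i).
  by apply: card_le_inj; rewrite card_ord cY.
exists f, g; split=> // i j; rewrite EXY inE.
by apply/andP; split; [exact: fX|exact: gY].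
Qed.

Lemma logn_prod (I : finType) (p : nat) (W : {set I}) (F : I -> nat) :
  (forall i, i \in W -> 0 < F i) ->
  logn p (\prod_(i in W) F i) = \sum_(i in W) logn p (F i).
Proof.
move=> F0; suff [] : 0 < \prod_(i in W) F i /\
    logn p (\prod_(i in W) F i) = \sum_(i in W) logn p (F i) by [].
elim/big_rec2: _ => [|i x y iW [y0 yE]]; first by rewrite logn1.
by rewrite muln_gt0 F0 // lognM ?F0 // yE.
Qed.

(** When [p] divides each factor at most once, the number of multiples of [p] is the exponent of [p]
    in the product, a multiple of [d]. *)
Lemma dvdn_card_multiples (I : finType) (p d x : nat) (W : {set I}) (F : I -> nat) :
    prime p -> (forall i, i \in W -> 0 < F i /\ logn p (F i) <= 1) ->
    \prod_(i in W) F i = x ^ d ->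
  d %| #|[set i in W | p %| F i]|.
Proof.
move=> pp FW prodE; have := congr1 (logn p) prodE.
rewrite logn_prod ?lognX => [E|i /FW[]//].
suff -> : #|[set i in W | p %| F i]| = \sum_(i in W) logn p (F i).
  by rewrite E dvdn_mulr.
rewrite -sum1_card big_mkcond [RHS]big_mkcond /=; apply: eq_bigr => i _.
rewrite inE; have [iW|//] := boolP (i \in W); have [F0 F1] := FW i iW.
have := logn_gt0 p (F i); rewrite mem_primes pp F0 /=.
by case: (logn p (F i)) F1 => [|[|]] //= _ <-.
Qed.

Lemma logn_prime_mul_le1 (p r1 r2 : nat) :
  prime r1 -> prime r2 -> r1 != r2 -> logn p (r1 * r2) <= 1.
Proof.
move=> pr1 pr2 r12; rewrite lognM ?prime_gt0 // !logn_prime //.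
by have [->|] := eqVneq p r1; [rewrite (negbTE r12)|rewrite leq_b1].
Qed.

Lemma Fkd_ge (n s k : nat) : 0 < k -> 2 <= s -> s ^ 2 <= n ->
    2 * (2 ^ k) ^ 3 <= #|[set p : 'I_s.+1 | prime p]| ->
  #|[set p : 'I_n.+1 | prime p]| + #|[set p : 'I_n.+1 | prime p && (p.*2 <= n)]|
    + (2 ^ k) ^ 2 * (2 ^ k - 1) * ((2 ^ k) ^ 2 - 1)
  <= Fkd 9 3 n + 2 * #|[set p : 'I_s.+1 | prime p]|.
Proof.
move=> k0 s2 sn qs; have sln : s <= n.
  by apply: leq_trans sn; rewrite -mulnn leq_pmulr //; lia.
have [V [e [eF cardV cardE]]] := exists_dense_K33_free k0.
(* Labelling the disjoint sum [V + V] keeps the primes on the two sides distinct, so every edge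
   product is squarefree and determines its edge. *)
have [h hI hP] : exists2 h : V + V -> 'I_s.+1, injective h & forall w, prime (h w).
  apply: (card_le_inj (P := fun p : 'I_s.+1 => prime p)).
  rewrite card_sum addnn -mul2n; apply:
    leq_trans (_ : #|[set p : 'I_s.+1 | prime p]| <= _).
    by apply: leq_trans qs; rewrite leq_mul2l cardV.
  by rewrite cardsE.
pose f u : nat := h (inl u); pose g v : nat := h (inr v).
have fP u : prime (f u) by apply: hP.
have gP v : prime (g v) by apply: hP.
have fI : injective f by move=> u u' /ord_inj/hI[].
have gI : injective g by move=> v v' /ord_inj/hI[].
have fg u v : f u != g v by apply/eqP => /ord_inj/hI; discriminate.
have fs u : f u <= s by rewrite -ltnS ltn_ord.
have gs v : g v <= s by rewrite -ltnS ltn_ord.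
have fgn u v : f u * g v < n.+1.
  by rewrite ltnS; apply: leq_trans sn; rewrite -mulnn leq_mul.
have f_dvd u u' v : (f u %| f u' * g v) = (u' == u).
  by rewrite Euclid_dvdM // !dvdn_prime2 // (negbTE (fg _ _)) orbF (inj_eq fI) eq_sym.
have g_dvd v u v' : (g v %| f u * g v') = (v' == v).
  by rewrite Euclid_dvdM // !dvdn_prime2 // [g v == f u]eq_sym
    (negbTE (fg _ _)) (inj_eq gI) eq_sym.
pose pt (w : V * V) : 'I_n.+1 := Ordinal (fgn w.1 w.2).
have ptI : injective pt.
  move=> [u v] [u' v'] /(congr1 val) /= E; congr (_, _); apply/eqP.
    by rewrite -(f_dvd u' u v) E dvdn_mulr.
  by rewrite -(g_dvd v' u v) E dvdn_mull.
pose E := [set w : V * V | e w.1 w.2].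
have cardEE : #|E| = \sum_u #|e u|.
  under eq_bigr do rewrite -sum1_card.
  by rewrite pair_big_dep /= -sum1_card; apply: eq_bigl => w; rewrite inE.
pose L1 := [set p : 'I_n.+1 | prime p && (s < p)].
pose M2 := [set p : 'I_n.+1 | (prime p && (p.*2 <= n)) && (s < p)].
(* Outside [M2] this may be the default value of [inord]; [dblE] therefore assumes membership in
   [M2]. *)
pose dbl (p : 'I_n.+1) : 'I_n.+1 := inord p.*2.
have dblE p : p \in M2 -> dbl p = p.*2 :> nat.
  by rewrite inE => /andP[/andP[_ pn] _]; rewrite inordK.
pose L2 := dbl @: M2; pose G := pt @: E.
have widenI : injective (widen_ord (sln : s.+1 <= n.+1)).
  by move=> p p' /(congr1 val) /= /ord_inj.
(* Dropping the primes up to [s] costs at most their number. It is used once for [L1] and once for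
   [L2], whence the factor 2 in the statement. *)
have card_large (P : pred 'I_n.+1) : (forall p, P p -> prime p) ->
    #|[set p | P p]|
      <= #|[set p : 'I_n.+1 | P p && (s < p)]| + #|[set p : 'I_s.+1 | prime p]|.
  move=> Pp; rewrite -(card_imset _ widenI) -[X in X <= _]
    (cardsID [set p : 'I_n.+1 | s < p]).
  apply: leq_add; apply/subset_leq_card/fintype.subsetP => p; rewrite !inE //.
  rewrite -leqNgt => /andP[ps /Pp pp]; apply/imsetP.
  by exists (Ordinal (ps : p < s.+1)); [rewrite inE|apply: ord_inj].
have cardL1 : #|[set p : 'I_n.+1 | prime p]| <= #|L1| + #|[set p : 'I_s.+1 | prime p]|.
  by apply: card_large.
have cardL2 : #|[set p : 'I_n.+1 | prime p && (p.*2 <= n)]|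
    <= #|L2| + #|[set p : 'I_s.+1 | prime p]|.
  rewrite card_in_imset; first by apply: card_large => p /andP[].
  by move=> p p' pM p'M /(congr1 val) /=; rewrite !dblE // => /double_inj/ord_inj.
have cardG : #|G| = #|E| by rewrite card_imset.
pose A := L1 :|: L2 :|: G.
have L1P m : m \in L1 -> prime m /\ s < m by rewrite inE => /andP[].
have L2P m : m \in L2 -> exists p : nat, [/\ prime p, s < p & m = p.*2 :> nat].
  case/imsetP => p pM ->; exists p; rewrite dblE //; move: pM.
  by rewrite inE => /andP[/andP[]].
have GP m : m \in G -> exists u v, e u v /\ m = f u * g v :> nat.
  by case/imsetP => -[u v]; rewrite inE /= => euv ->; exists u, v.
have cardA : #|A| = #|L1| + #|L2| + #|G|.
  have disj12 : L1 :&: L2 = finset.set0.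
    apply/finset.setP => m; rewrite finset.in_setI finset.in_set0; apply/negP.
    case/andP => /L1P[pm sm] /L2P[p [pp sp mE]].
    have : 2 %| m by rewrite mE -muln2 dvdn_mull.
    by rewrite dvdn_prime2 // => /eqP m2; move: sm; rewrite -m2 ltnNge s2.
  have disj12G : (L1 :|: L2) :&: G = finset.set0.
    apply/finset.setP => m; rewrite finset.in_setI finset.in_set0; apply/negP.
    case/andP => m12 /GP[u [v [_ mE]]].
    have [p [pp sp]] : exists p, [/\ prime p, s < p & p %| m].
      case/finset.setUP: m12 => [/L1P[pm sm]|/L2P[p [pp sp ->]]]; first by exists m.
      by exists p; rewrite -muln2 dvdn_mulr.
    by rewrite mE Euclid_dvdM // !dvdn_prime2 // => /orP[] /eqP pE;
      move: sp; rewrite pE ltnNge ?fs ?gs.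
  by rewrite /A !cardsU disj12G disj12 !cards0 !subn0.
have Afree : power_product_free 9 3 A.
  split.
    rewrite /A !finset.in_setU; apply/norP; split; first apply/norP; first split.
    - by apply/negP => /L1P[_].
    - by apply/negP => /L2P[p [/prime_gt0 p0 _ /= pE]]; rewrite -double_gt0 -pE in p0.
    - apply/negP => /GP[u [v [_ /= E0]]].
      have : 0 < f u * g v by rewrite muln_gt0 !prime_gt0.
      by rewrite -E0.
  case/has_power_productP => W [WA W9 [x prodE]].
  have W_sqfree p m : m \in W -> 0 < m /\ logn p m <= 1.
    move/(fintype.subsetP WA); rewrite !finset.in_setU.
    case/orP => [/orP[/L1P[pm _]|/L2P[r [pr sr ->]]]|/GP[u [v [_ ->]]]].
    - by rewrite prime_gt0 // logn_prime //; case: (p == m).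
    - rewrite double_gt0 prime_gt0 // -muln2 logn_prime_mul_le1 //.
      by rewrite gtn_eqF // (leq_ltn_trans s2).
    - by rewrite muln_gt0 !prime_gt0 // logn_prime_mul_le1.
  have W_mult p : prime p -> 3 %| #|[set m in W | p %| m]|.
    by move=> pp; apply: dvdn_card_multiples prodE => // m; apply: W_sqfree.
  have WG : W \subset G.
    apply/fintype.subsetP => m mW; have := fintype.subsetP WA m mW.
    rewrite finset.in_setU => /orP[m12|//]; exfalso.
    have [p [pp sp mE]] : exists p : nat,
        [/\ prime p, s < p & m = p :> nat \/ m = p.*2 :> nat].
      case/finset.setUP: m12 => [/L1P[pm sm]|/L2P[p [pp sp mE]]].
        by exists m; split=> //; left.
      by exists p; split=> //; right.
    have pm : p %| m by case: mE => ->; rewrite -?muln2 ?dvdn_mulr.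
    have pn : p < n.+1.
      apply: leq_trans (ltn_ord m); rewrite ltnS.
      by apply: dvdn_leq pm; case: (W_sqfree 2 m mW).
    (* Only [p] and [2 p] can be multiples of [p] in [A], while a nonempty set of multiples in [W]
       has at least three elements. *)
    have le2 : #|[set m' in W | p %| m']| <= 2.
      have sub : [set m' in W | p %| m']
          \subset [set (Ordinal pn : 'I_n.+1); dbl (Ordinal pn)].
        apply/fintype.subsetP => m'; rewrite !inE => /andP[m'W pm'].
        have := fintype.subsetP WA m' m'W; rewrite !finset.in_setU.
        case/orP => [/orP[/L1P[pm'' _]|/L2P[r [pr sr m'E]]]|/GP[u [v [_ m'E]]]].
        + by apply/orP; left; rewrite dvdn_prime2 // in pm'; apply/eqP/ord_inj/esym/eqP.
        + apply/orP; right; apply/eqP/ord_inj; rewrite m'E -muln2 Euclid_dvdM // in pm'.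
          have rp : r = p.
            case/orP: pm'; rewrite dvdn_prime2 // => /eqP // p2.
            by move: sp; rewrite p2 ltnNge s2.
          by rewrite inordK /= -?rp -m'E.
        + move: pm'; rewrite m'E Euclid_dvdM // !dvdn_prime2 // => /orP[] /eqP pE;
            by rewrite pE ltnNge ?fs ?gs in sp.
      by apply: leq_trans (subset_leq_card sub) _; rewrite cards2; case: eqP.
    have gt0 : 0 < #|[set m' in W | p %| m']|.
      by apply/card_gt0P; exists m; rewrite inE mW.
    by have := dvdn_leq gt0 (W_mult p pp); rewrite leqNgt ltnS le2.
  pose EW := pt @^-1: W.
  have WE : W = pt @: EW.
    apply/finset.setP => m; apply/idP/imsetP => [mW|[w]]; last by rewrite inE => wW ->.
    have /imsetP[w _ mE] := fintype.subsetP WG m mW.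
    by exists w => //; rewrite inE -mE.
  have EWE w : w \in EW -> e w.1 w.2.
    by rewrite inE => /(fintype.subsetP WG)/imsetP[w']; rewrite inE => e' /ptI->.
  have fib (F : V * V -> V) (r : V -> nat) : (forall u, prime (r u)) ->
      (forall u w, (r u %| pt w) = (F w == u)) ->
      forall u, 3 %| #|[set w in EW | F w == u]|.
    move=> rP rF u; suff <- : #|[set m in W | r u %| m]| = #|[set w in EW | F w == u]|.
      exact: W_mult.
    rewrite -(card_imset _ ptI); apply: eq_card => m; rewrite inE WE.
    apply/andP/imsetP => [[/imsetP[w wE ->]]|[w]].
      by rewrite rF => Fw; exists w => //; rewrite inE wE.
    by rewrite inE => /andP[wE Fw] ->; rewrite rF Fw imset_f.
  have EW9 : #|EW| = 9 by rewrite -W9 WE card_imset.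
  have [a [b [aI bI ab]]] := nine_edges_K33 EW9
    (fib fst f fP (fun u w => f_dvd u w.1 w.2))
    (fib snd g gP (fun v w => g_dvd v w.1 w.2)).
  by apply: (eF a b aI bI) => i j; apply: (EWE (a i, b j)).
have : #|A| <= Fkd 9 3 n.
  by rewrite /Fkd; apply: (bigop.bigmax_sup A) => //; apply/asboolP.
rewrite cardA cardG cardEE; move: cardE cardL1 cardL2; lia.
Qed.

(** * Asymptotics *)

Lemma primepi_natr (R : realType) (n : nat) :
  primepi (n%:R%R : R) = #|[set p : 'I_n.+1 | prime p]|.
Proof. by rewrite /primepi natrK. Qed.

Lemma primepi_half (R : realType) (n : nat) :
  primepi (n%:R / 2 : R)%R = #|[set p : 'I_n.+1 | prime p && (p.*2 <= n)]|.
Proof.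
have truncE : Num.truncn (n%:R / 2 : R)%R = n./2.
  have n2 : (n%:R = n./2%:R * 2 + (odd n)%:R :> R)%R.
    by rewrite -[in LHS](odd_double_half n) natrD -muln2 natrM addrC.
  have o0 : (0 <= (odd n)%:R :> R)%R by rewrite ler0n.
  have o1 : ((odd n)%:R <= 1 :> R)%R by case: odd; rewrite ?lexx ?ler01.
  apply/eqP; rewrite eqn_leq truncn_le_nat truncn_ge_nat ?divr_ge0 ?ler0n //.
  rewrite -[n./2.+1]addn1 natrD; apply/andP; split; lra.
have le2 : n./2.+1 <= n.+1 by rewrite ltnS; lia.
rewrite /primepi truncE.
rewrite -(card_imset _ (f := widen_ord le2)); last first.
  by move=> p p' /(congr1 val) /= /ord_inj.
apply: eq_card => p; rewrite inE; apply/imsetP/andP => [[p' pp ->]|[pp pn]] /=.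
  by move: pp; rewrite inE => ->; rewrite -geq_half_double -ltnS.
have ph : p < n./2.+1 by rewrite ltnS geq_half_double.
by exists (Ordinal ph); [rewrite inE|apply: ord_inj].
Qed.

Lemma Fkd_excess_le (n : nat) : 0 < n -> exists2 t : nat, t ^ 6 <= n &
  Fkd 9 3 n <= #|[set p : 'I_n.+1 | prime p]|
    + #|[set p : 'I_n.+1 | prime p && (p.*2 <= n)]| + 178 * (8 * t) ^ 5.
Proof.
move=> n0; have c1 : 1 < 8 ^ 6 by rewrite -[1]/(8 ^ 0) ltn_exp2l.
have /andP[] := trunc_log_bounds c1 n0; set k := trunc_log _ _ => kn nk.
exists (8 ^ k); first by rewrite -expnM mulnC expnM.
rewrite -expnS; apply/bigop.bigmax_leqP => A /asboolP Afree.
by apply: card_power_product_free_le => //; rewrite -expnM mulnC expnM.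
Qed.

(** Takes [s = 2 ^ e] with [4 ^ e <= n < 4 ^ e.+1], and [q] the largest power of 2 such that
    [2 * q ^ 3] primes are available up to [s]. Then [2 ^ e.+1 <= 4 * e * P <= 64 * e * q ^ 3]. *)
Lemma Fkd_excess_ge (n : nat) : 4 ^ 19 <= n ->
  exists e q : nat, [/\ 4 ^ e <= n, n <= (64 * e * q ^ 3) ^ 2 &
    4 * (#|[set p : 'I_n.+1 | prime p]|
      + #|[set p : 'I_n.+1 | prime p && (p.*2 <= n)]|) + q ^ 5
    <= 4 * Fkd 9 3 n].
Proof.
move=> nN; have n0 : 0 < n by apply: leq_trans nN; rewrite expn_gt0.
have /andP[] := trunc_log_bounds (isT : 1 < 4) n0; set e := trunc_log _ _ => en ne.
have e19 : 19 <= e by rewrite -ltnS -(ltn_exp2l _ _ (isT : 1 < 4)) (leq_ltn_trans nN).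
have e0 : 0 < e by apply: leq_trans e19.
have := card_primes_expn2_ge e0; set P := #|_| => eP.
(* This needs [e <= 2 ^ (e - 14)], true from [e = 19] on. It yields [q >= 16], enough for the edges
   to outweigh the loss of [2 * P] in [q5]. *)
have P13 : 2 ^ 13 <= P.
  rewrite -(leq_pmul2l e0); apply: leq_trans eP.
  rewrite (_ : e.-1 = e - 14 + 13); last by lia.
  rewrite expnD leq_mul2r; apply/orP; right.
  rewrite -{1}(subnK e19) (_ : e - 14 = e - 19 + 5); last by lia.
  rewrite expnD; have := ltn_expl (e - 19) (isT : 1 < 2).
  by rewrite -[2 ^ 5]/32; lia.
have P2 : 8 ^ 4 <= P./2.
  by rewrite geq_half_double -muln2 -[8]/(2 ^ 3) -expnM -expnSr.
have P20 : 0 < P./2 by apply: leq_trans P2; rewrite expn_gt0.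
have /andP[] := trunc_log_bounds (isT : 1 < 8) P20; set k := trunc_log _ _ => kP Pk.
have k4 : 4 <= k by rewrite -ltnS -(ltn_exp2l _ _ (isT : 1 < 8)) (leq_ltn_trans P2).
set q := 2 ^ k.
have q8 : 8 ^ k = q ^ 3 by rewrite -[8]/(2 ^ 3) -!expnM mulnC.
have q16 : 16 <= q by rewrite -[16]/(2 ^ 4) leq_exp2l.
rewrite expnS q8 in Pk; rewrite q8 in kP.
have Pq : P <= 16 * q ^ 3.
  by rewrite -(odd_double_half P) -mul2n; case: odd; lia.
have qP : 2 * q ^ 3 <= P by rewrite mul2n -geq_half_double.
have sn : (2 ^ e) ^ 2 <= n by rewrite -expnM mulnC expnM.
have s2 : 2 <= 2 ^ e by rewrite -[2]/(2 ^ 1) leq_exp2l.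
have k0 : 0 < k by apply: leq_trans k4.
have := Fkd_ge k0 s2 sn qP; rewrite -/P -/q => Fge.
exists e, q; split=> //.
  apply: leq_trans (ltnW ne) _; rewrite -[4]/(2 ^ 2) -expnM mulnC expnM.
  rewrite leq_exp2r // (_ : e.+1 = e.-1 + 2); last by lia.
  rewrite expnD -[2 ^ 2]/4; nia.
have q5 : q ^ 5 + 8 * P <= 4 * (q ^ 2 * (q - 1) * (q ^ 2 - 1)).
  apply: (@leq_trans (q ^ 2 * (q ^ 3 + 128 * q))).
    by move: Pq; rewrite !expnS expn0; nia.
  have -> : 4 * (q ^ 2 * (q - 1) * (q ^ 2 - 1))
      = q ^ 2 * ((2 * (q - 1)) * (2 * (q ^ 2 - 1))).
    by move: (q - 1) (q ^ 2 - 1) => x y; ring.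
  have q2 : 130 <= q ^ 2 by apply: leq_trans (_ : 16 ^ 2 <= _) => //; rewrite leq_exp2r.
  have h1 : q <= 2 * (q - 1) by lia.
  have h2 : q ^ 2 + 128 <= 2 * (q ^ 2 - 1) by lia.
  rewrite leq_mul2l (leq_trans _ (leq_mul h1 h2)) ?orbT //.
  by rewrite mulnDr -expnS [128 * q]mulnC.
lia.
Qed.

Local Open Scope ring_scope.

Lemma natr_le_ln (R : realType) (e n : nat) :
  (0 < n)%N -> (4 ^ e <= n)%N -> e%:R <= ln n%:R :> R.
Proof.
(* The inequality [ln (1 + x) <= x] at [x = - 1 / 2] gives [ln 2 >= 1 / 2], hence [ln 4 >= 1]. *)
move=> n0 en; have ln2 : 2^-1 <= ln 2 :> R.
  have := @le_ln1Dx R (- 2^-1) ltac:(lra).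
  have -> : 1 + - 2^-1 = 2^-1 :> R by lra.
  by rewrite lnV ?posrE // lerNl opprK.
have ln4 : 1 <= ln 4 :> R.
  have -> : 4 = 2 ^+ 2 :> R by rewrite -natrX.
  by rewrite lnXn //; lra.
have le : (4 ^+ e) <= n%:R :> R by rewrite -natrX ler_nat.
apply: le_trans (_ : ln (4 ^+ e) <= _).
  by rewrite lnXn // -[X in X <= _]mulr1 -[X in _ <= X]mulr_natl ler_wpM2l.
by rewrite ler_ln // posrE ?exprn_gt0 ?ltr0n.
Qed.

Lemma powR_exprn (R : realType) (x s : R) (m : nat) :
  0 <= x -> (x ^+ m) `^ s = x `^ (m%:R * s).
Proof. by move=> x0; rewrite -powR_mulrn // -powRrM. Qed.

Lemma powR_sqr_prod (R : realType) (c L Q : R) : 0 <= c -> 0 <= L -> 0 <= Q ->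
  ((c * L * Q ^+ 3) ^+ 2) `^ (5 / 6) = c `^ (5 / 3) * L `^ (5 / 3) * Q ^+ 5.
Proof.
move=> c0 L0 Q0; rewrite powR_exprn ?mulr_ge0 ?exprn_ge0 //.
have -> : 2 * (5 / 6) = 5 / 3 :> R by field.
rewrite (powRM _ (mulr_ge0 c0 L0) (exprn_ge0 3 Q0)) (powRM _ c0 L0) powR_exprn //.
have -> : 3 * (5 / 3) = 5 :> R by field.
by rewrite powR_mulrn.
Qed.

Theorem theorem11 (R : realType) :
  let E : nat -> R := fun n =>
    (Fkd 9 3 n)%:R - ((primepi (n%:R : R))%:R + (primepi (n%:R / 2 : R))%:R) in
  vinogradov_le (fun n : nat => n%:R `^ (5 / 6) / (ln n%:R) `^ (5 / 3)) E /\
  vinogradov_le E (fun n : nat => n%:R `^ (5 / 6)).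
Proof.
move=> E; split.
  (* The bound [n <= (64 * ln n * q ^ 3) ^ 2] raised to the power 5/6 gives [64 ^ (5 / 3)]; the 4 is
     the one in [Fkd_excess_ge]. *)
  exists (4 * 64 `^ (5 / 3)); first by rewrite mulr_gt0 // powR_gt0.
  exists (4 ^ 19)%N => // n /= nN; rewrite /E primepi_natr primepi_half.
  have n0 : (0 < n)%N by apply: leq_trans nN; rewrite expn_gt0.
  have [e [q [en nq Fge]]] := Fkd_excess_ge nN.
  have eL := natr_le_ln R n0 en.
  have L0 : 0 < ln n%:R :> R.
    rewrite ln_gt0 // ltr1n; apply: leq_trans nN.
    by rewrite -[1%N]/(4 ^ 0)%N ltn_exp2l.
  set L : R := ln n%:R in eL L0 *.
  have nqL : n%:R <= (64 * L * q%:R ^+ 3) ^+ 2 :> R.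
    apply: le_trans (_ : ((64 * e * q ^ 3) ^ 2)%N%:R <= _); first by rewrite ler_nat.
    rewrite natrX natrM natrX natrM lerXn2r
      ?nnegrE ?mulr_ge0 ?exprn_ge0 ?ler0n ?(ltW L0) //.
    by rewrite ler_wpM2r ?exprn_ge0 // ler_wpM2l.
  rewrite ler_pdivrMr ?powR_gt0 //.
  have x0 : 0 <= (64 * L * q%:R ^+ 3) ^+ 2 :> R.
    by rewrite exprn_ge0 // !mulr_ge0 ?exprn_ge0 // ltW.
  have s0 : 0 <= 5 / 6 :> R by rewrite divr_ge0.
  apply: le_trans (ge0_ler_powR s0 _ x0 nqL) _; first by rewrite nnegrE.
  rewrite powR_sqr_prod ?ler0n ?(ltW L0) // -!mulrA
    [X in _ <= X]mulrCA ler_wpM2l ?powR_ge0 //.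
  rewrite [X in _ <= X]mulrA mulrC ler_wpM2r ?powR_ge0 //.
  clear nN en nq nqL; move: Fge; rewrite -(ler_nat R) natrD natrX !natrM !natrD; lra.
exists (178 * 8 ^+ 5); first by rewrite mulr_gt0 // exprn_gt0.
exists 1%N => // n /= n0; rewrite /E primepi_natr primepi_half.
have [t tn] := Fkd_excess_le n0.
rewrite -(ler_nat R) natrD natrM natrX natrM natrD => Fle.
have t5 : t%:R ^+ 5 <= n%:R `^ (5 / 6) :> R.
  have -> : t%:R ^+ 5 = (t%:R ^+ 6) `^ (5 / 6) :> R.
    rewrite powR_exprn //; have -> : 6 * (5 / 6) = 5 :> R by field.
    by rewrite powR_mulrn.
  by apply: ge0_ler_powR; rewrite ?nnegrE ?exprn_ge0 // -?natrX ?ler_nat ?divr_ge0.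
rewrite lerBlDl; apply: le_trans Fle _; rewrite lerD2l exprMn mulrA.
by rewrite ler_wpM2l // mulr_ge0 // exprn_ge0.
Qed.
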